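(* Let $k\ge 1$, $r\ge 2$ and $n\ge r+k$ be integers. Then $$\mathrm{ex}_{\to}(n,CP^r_k)=\begin{cases}\displaystyle \binom{n}{r}-\binom{n-k+1}{r} & \text{for } k\le r+1,\\[2mm] \Theta(n^{r-1}\log n) & \text{for } k\ge r+2.\end{cases}$$
   Context: An ordered $r$-graph is an $r$-uniform hypergraph whose vertex set is linearly ordered. An ordered $r$-graph $H$ contains an ordered $r$-graph $F$ if there is an order-preserving injection $V(F)\to V(H)$ mapping edges of $F$ to edges of $H$. $\mathrm{ex}_{\to}(n,F)$ is the maximum number of edges in an $n$-vertex ordered $r$-graph that does not contain $F$. A tight $k$-path $v_0v_1\dots v_{k+r-2}$ is an $r$-graph on distinct vertices $v_0,\dots,v_{k+r-2}$ whose edges are $\{v_i,v_{i+1},\dots,v_{i+r-1}\}$ for $0\le i<k$. The $r$-uniform crossing $k$-path $CP^r_k$ is the tight $k$-path $v_0v_1\dots v_{r+k-2}$ with vertex ordering satisfying: (i) $v_0<v_1<\dots<v_{r-1}$; (ii) $v_j<v_{j+r}<v_{j+2r}<\cdots<v_{j+1}$ for each $0\le j<r-1$; (iii) $v_{r-1}<v_{2r-1}<v_{3r-1}<\cdots$ (only indices at most $r+k-2$ occur). The $\Theta$ notation is as $n\to\infty$ with $k,r$ fixed. *)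

(* Defs.v *)
From mathcomp Require Import all_boot all_order.

Set Implicit Arguments.
Unset Strict Implicit.
Unset Printing Implicit Defensive.

Import Order.TTheory.

(* An ordered hypergraph is given by its edge set E : {set {set V}} over a
   finite totally ordered vertex type V. *)

Definition uniform (r : nat) (V : finType) (E : {set {set V}}) : bool :=
  [forall e in E, #|e| == r].

(* Between total orders, an order-preserving injection is the same thing as a
   strictly increasing map. *)
Definition contains (dV dW : Order.disp_t)
    (V : finOrderType dV) (W : finOrderType dW)
    (H : {set {set W}}) (F : {set {set V}}) : bool :=
  [exists f : {ffun V -> W},
     [forall x : V, forall y : V, (x < y)%O ==> (f x < f y)%O] &&
     [forall e in F, f @: e \in H]].

(* Every linear order on n points is isomorphic to 'I_n, so the n-vertex host
   graphs are taken to be those on 'I_n. *)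
Definition ex_ord (r n : nat) (d : Order.disp_t) (V : finOrderType d)
    (F : {set {set V}}) : nat :=
  \max_(H : {set {set 'I_n}} | uniform r H && ~~ contains H F) #|H|.

(* v lists all the vertices of V, v_0, ..., v_(k+r-2), without repetition. *)
Definition tight_path (r k : nat) (V : finType)
    (v : 'I_(k + r - 1) -> V) (E : {set {set V}}) : Prop :=
  bijective v /\
  E = [set [set v j | j : 'I_(k + r - 1) & i <= j < i + r] | i : 'I_k].

Arguments tight_path r k {V} v E.

(* The second component has two parts because the chain
   v_j < v_(j+r) < v_(j+2r) < ... < v_(j+1) consists of the inequalities
   between consecutive v_a with a = j mod r, and the fact that each of these
   v_a is below v_(j+1). *)
Definition crossing_order (r m : nat) (d : Order.disp_t) (V : finOrderType d)
    (v : 'I_m -> V) : Prop :=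
  [/\ forall a b : 'I_m, a < b -> b < r -> (v a < v b)%O,
      forall j : nat, j < r - 1 ->
        (forall a b : 'I_m, a = j %[mod r] -> b = a + r :> nat ->
           (v a < v b)%O) /\
        (forall a b : 'I_m, a = j %[mod r] -> b = j + 1 :> nat ->
           (v a < v b)%O)
    & forall a b : 'I_m, a = r - 1 %[mod r] -> b = a + r :> nat ->
        (v a < v b)%O].

Definition crossing_path (r k : nat) (d : Order.disp_t) (V : finOrderType d)
    (E : {set {set V}}) : Prop :=
  exists v : 'I_(k + r - 1) -> V, tight_path r k v E /\ crossing_order r v.

Section CrossingLex.
Variables (r m : nat).
Hypothesis r_gt0 : 0 < r.

(* The linear order forced by crossing_order: first by residue mod r, then by
   quotient. *)
Definition crossing_lt (a b : nat) : bool :=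
  (a %% r < b %% r) || (a %% r == b %% r) && (a < b).

Lemma crossing_lt_irr a : crossing_lt a a = false.
Proof. by rewrite /crossing_lt !ltnn andbF. Qed.

Lemma crossing_lt_trans b a c :
  crossing_lt a b -> crossing_lt b c -> crossing_lt a c.
Proof.
rewrite /crossing_lt => /orP[h1|/andP[/eqP-> h1]] /orP[h2|/andP[/eqP h2 h3]].
- by rewrite (ltn_trans h1 h2).
- by rewrite -h2 h1.
- by rewrite h2.
- by rewrite h2 eqxx (ltn_trans h1 h3) orbT.
Qed.

Lemma crossing_lt_total a b : a != b -> crossing_lt a b || crossing_lt b a.
Proof.
by rewrite /crossing_lt; case: (ltngtP (a %% r) (b %% r)) => //= _; case: ltngtP.
Qed.

Lemma crossing_orderP (d : Order.disp_t) (V : finOrderType d) (v : 'I_m -> V) :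
  r <= m -> crossing_order r v <->
  (forall a b : 'I_m, (v a < v b)%O = crossing_lt a b).
Proof.
move=> le_rm; split; last first.
  move=> h; split.
  - move=> a b ab br; rewrite h /crossing_lt !modn_small ?ab //.
    exact: ltn_trans ab br.
  - move=> j jr; split=> a b aj ab; rewrite h /crossing_lt ab.
      by rewrite modnDr eqxx -{3}(addn0 a) ltn_add2l r_gt0 orbT.
    have j1r : j + 1 < r by rewrite addnC -ltn_subRL.
    have jr' : j < r by apply: ltn_trans j1r; rewrite addn1.
    by rewrite aj !modn_small // addn1 ltnSn.
  - move=> a b aj ab; rewrite h /crossing_lt ab.
    by rewrite modnDr eqxx -{3}(addn0 a) ltn_add2l r_gt0 orbT.
case=> h1 h2 h3.
have step (a b : 'I_m) : b = a + r :> nat -> (v a < v b)%O.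
  move=> ab; have : a %% r < r by rewrite ltn_mod.
  rewrite -[X in _ < X](subnK r_gt0) addn1 ltnS leq_eqVlt => /orP[/eqP e|lt].
    by apply: h3 => //; rewrite -e modn_mod.
  by have [+ _] := h2 _ lt; apply=> //; rewrite modn_mod.
have steps q (a b : 'I_m) : b = a + q.+1 * r :> nat -> (v a < v b)%O.
  elim: q b => [|q IH] b; first by rewrite mul1n; apply: step.
  move=> e; have cm : a + q.+1 * r < m.
    apply: leq_ltn_trans (ltn_ord b); rewrite e leq_add2l leq_mul2r.
    by rewrite leqnSn orbT.
  apply: (lt_trans (IH (Ordinal cm) erefl)); apply: step.
  by rewrite e /= mulSn addnCA addnC.
have low (b : 'I_m) (c : 'I_m) : c = b %% r :> nat -> (v c <= v b)%O.
  move=> e; case eq: (b %/ r) => [|q].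
    suff -> : c = b by [].
    by apply/val_inj; rewrite /= e [RHS](divn_eq b r) eq mul0n add0n.
  by apply/ltW/(steps q); rewrite e {1}(divn_eq b r) eq addnC.
have imp (a b : 'I_m) : crossing_lt a b -> (v a < v b)%O.
  case/orP=> [lt|/andP[/eqP e ab]].
    have br : b %% r < r by rewrite ltn_mod.
    have cr : a %% r + 1 < r by rewrite addn1 (leq_ltn_trans lt).
    have ja : a %% r < r - 1 by rewrite ltn_subRL addnC.
    pose c := Ordinal (leq_trans cr le_rm).
    pose c' := Ordinal (leq_trans br le_rm).
    have lac : (v a < v c)%O.
      by have [_ +] := h2 _ ja; apply=> //; rewrite modn_mod.
    apply: (lt_le_trans lac); apply: (@le_trans _ _ (v c')); last exact: low.
    have : c <= c' by rewrite /= addn1.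
    rewrite leq_eqVlt => /orP[/eqP/val_inj-> //|cc].
    exact/ltW/h1.
  have lq : a %/ r < b %/ r.
    by move: ab; rewrite {1}(divn_eq a r) {1}(divn_eq b r) e ltn_add2r ltn_mul2r r_gt0.
  apply: (steps (b %/ r - a %/ r).-1).
  rewrite prednK ?subn_gt0 //.
  transitivity (a %/ r * r + a %% r + (b %/ r - a %/ r) * r).
    by rewrite addnAC -mulnDl subnKC ?(ltnW lq) // e -divn_eq.
  by rewrite -divn_eq.
move=> a b; apply/idP/idP; last exact: imp.
move=> ab; have nab : (a : nat) != b.
  by apply: contraTneq ab => /val_inj->; rewrite ltxx.
case/orP: (crossing_lt_total nab) => // /imp ba.
by have := lt_trans ab ba; rewrite ltxx.
Qed.

End CrossingLex.

Lemma crossing_path_exists (r k : nat) : 0 < k -> 1 < r ->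
  exists F : {set {set 'I_(k + r - 1)}}, crossing_path r k F.
Proof.
move=> k_gt0 r_gt1; set m := k + r - 1.
have r_gt0 : 0 < r by exact: ltnW.
have le_rm : r <= m by rewrite /m -addnBAC // leq_addl.
pose below (i : 'I_m) := [set j : 'I_m | crossing_lt r j i].
have lt_m i : #|below i| < m.
  rewrite -[X in _ < X]card_ord -cardsT; apply/proper_card/properP.
  by split; [exact: subsetT | exists i; rewrite ?inE ?crossing_lt_irr].
pose v i := Ordinal (lt_m i).
have mono (a b : 'I_m) : crossing_lt r a b -> (v a < v b)%O.
  move=> ab; suff : #|below a| < #|below b| by [].
  apply/proper_card/properP; split.
    by apply/subsetP=> c; rewrite !inE => /crossing_lt_trans; apply.
  by exists a; rewrite !inE ?crossing_lt_irr.
have v_inj : injective v.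
  move=> a b e; apply/eqP/negPn/negP => ab.
  have nab : (a : nat) != b by [].
  by case/orP: (crossing_lt_total r nab) => /mono; rewrite e ltxx.
exists [set [set v j | j : 'I_m & i <= j < i + r] | i : 'I_k], v.
split; first by split=> //; exact: injF_bij.
apply/(crossing_orderP r_gt0) => // a b; apply/idP/idP; last exact: mono.
move=> ab; have nab : (a : nat) != b.
  by apply: contraTneq ab => /val_inj->; rewrite ltxx.
case/orP: (crossing_lt_total r nab) => // /mono ba.
by have := lt_trans ab ba; rewrite ltxx.
Qed.

(* Main.v *)
(* An r-set is identified with the increasing tuple of its elements.  In these
   terms a crossing path is a walk whose i-th step raises coordinate i mod r,
   such that no value of a coordinate ever reaches a value of a later one.

   Upper bounds come from deletion: going backwards through the steps, delete
   for the current coordinate c those edges whose c-th entry is maximal among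
   the remaining edges with the same other entries.  If an edge survives all
   steps, it starts a walk.

   For k <= r + 1 every coordinate is raised at most once and such a walk is
   automatically crossing.  Replacing in each deleted edge the entry x_c by
   x_(c+1) - 1 injects the deleted edges into the "tight" r-sets, those with
   x_(c+1) = x_c + 1 for some c < k - 1 (where x_r = n).  Conversely the tight
   r-sets contain no crossing path, since its first edge is not tight, and the
   r-sets that are not tight are counted by closing up the k - 1 gaps.

   For k >= r + 2 the walk is kept crossing by fixing, for all consecutive
   entries, the scale of the smallest dyadic block containing both: such an
   entry pair then always lies on the two sides of the same midpoint.  Once the
   other entries are fixed, one of the two scales next to x_c is determined, so
   each step deletes O(n^(r-1) log n) edges.  The r-sets for which x_1 - x_0 is
   a power of 2 give the matching lower bound. *)

Require Import Defs.
From mathcomp Require Import all_boot all_order.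
From mathcomp Require Import zify.

Set Implicit Arguments.
Unset Strict Implicit.
Unset Printing Implicit Defensive.

(** * Increasing tuples and crossing paths *)

Section IncreasingTuples.
Variables r n : nat.
Implicit Types (x y : {ffun 'I_r -> 'I_n}) (T : {set {ffun 'I_r -> 'I_n}}).

Definition incr x := [forall i : 'I_r, forall j : 'I_r, (i < j) ==> (x i < x j)].

Lemma incrP x : reflect (forall i j : 'I_r, i < j -> x i < x j) (incr x).
Proof.
apply: (iffP forallP) => [h i j|h i]; first by move/forallP: (h i) => /(_ j)/implyP.
by apply/forallP => j; apply/implyP/h.
Qed.

(* Out of range the coordinate is n, which acts as an upper sentinel. *)
Definition coord x (c : nat) : nat := if insub c is Some i then x i else n.

Lemma coordE x (i : 'I_r) : coord x i = x i.
Proof. by rewrite /coord valK. Qed.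

Lemma coord_oversize x c : r <= c -> coord x c = n.
Proof. by move=> h; rewrite /coord insubF // ltnNge h. Qed.

Lemma coord_lt x c : c < r -> coord x c < n.
Proof. by move=> h; rewrite (coordE x (Ordinal h)). Qed.

Lemma coord_incr x c c' : incr x -> c < c' -> c' <= r -> coord x c < coord x c'.
Proof.
move=> /incrP xi cc'; rewrite leq_eqVlt => /orP[/eqP e|h].
  by rewrite (coord_oversize x (c := c')) ?e // coord_lt // -e.
by rewrite (coordE x (Ordinal h)) (coordE x (Ordinal (ltn_trans cc' h))) xi.
Qed.

Lemma coord_inj x y : (forall c, c < r -> coord x c = coord y c) -> x = y.
Proof.
by move=> h; apply/ffunP => i; apply/val_inj; rewrite /= -!coordE h.
Qed.

Definition img x := [set x i | i : 'I_r].

Lemma incr_inj x : incr x -> injective x.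
Proof.
move=> /incrP xi i j e; apply/val_inj.
by case: (ltngtP i j) => // /xi; rewrite e ltnn.
Qed.

Lemma card_img x : incr x -> #|img x| = r.
Proof. by move=> /incr_inj/card_imset->; rewrite card_ord. Qed.

Lemma img_inj : {in incr &, injective img}.
Proof.
move=> x y xi yi e; apply/ffunP => i.
have srt z : incr z -> sorted ltn (map (fun i => val (z i)) (enum 'I_r)).
  move=> /incrP zi; rewrite sorted_map.
  have: sorted ltn (map val (enum 'I_r)) by rewrite val_enum_ord iota_ltn_sorted.
  by rewrite sorted_map; apply: sub_sorted => a b /zi.
have : map (fun i => val (x i)) (enum 'I_r) = map (fun i => val (y i)) (enum 'I_r).
  apply/(irr_sorted_eq ltn_trans ltnn (srt _ xi) (srt _ yi)).
  suff sub z t : img z = img t ->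
      {subset map (fun i => val (z i)) (enum 'I_r)
           <= map (fun i => val (t i)) (enum 'I_r)}.
    by move=> u; apply/idP/idP; apply: sub.
  move=> zt _ /mapP[j _ ->].
  have /imsetP[l _ ->] : z j \in img t by rewrite -zt imset_f.
  by apply/mapP; exists l; rewrite ?mem_enum.
by move/eq_in_map => /(_ i (mem_enum _ _)) /val_inj.
Qed.

Lemma imgP (A : {set 'I_n}) : #|A| = r -> exists2 x, incr x & A = img x.
Proof.
move=> cA.
pose f (i : 'I_r) : 'I_n := Order.enum_val (cast_ord (esym cA) i).
have fm (i j : 'I_r) : i < j -> f i < f j.
  move=> ij; have := Order.POrderTheory.leW_mono
    (Order.le_enum_val (A := A) (@Order.TotalTheory.le_total _ _)).
  move=> /(_ (cast_ord (esym cA) i) (cast_ord (esym cA) j)).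
  by move=> e; have : (cast_ord (esym cA) i < cast_ord (esym cA) j)%O by []; rewrite -e.
exists [ffun i => f i]; first by apply/incrP => i j /fm; rewrite !ffunE.
apply/setP => a; apply/idP/imsetP => [aA|[i _ ->]]; last first.
  by rewrite ffunE Order.enum_valP.
exists (cast_ord cA (Order.enum_rank_in aA a)) => //.
by rewrite ffunE /f cast_ordK Order.enum_rankK_in.
Qed.

Definition sorted_edges (H : {set {set 'I_n}}) := [set x | incr x & img x \in H].

Lemma card_sorted_edges H : uniform r H -> #|sorted_edges H| = #|H|.
Proof.
move/forall_inP => uH.
have e : img @: sorted_edges H = H.
  apply/setP => A; apply/imsetP/idP => [[x + ->]|AH]; first by rewrite inE => /andP[].
  have [x xi ex] := imgP (eqP (uH _ AH)).
  by exists x => //; rewrite inE xi -ex AH.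
rewrite -{2}e card_in_imset // => x y; rewrite !inE => /andP[xi _] /andP[yi _].
exact: img_inj.
Qed.

Lemma sorted_edgesK T : T \subset incr -> sorted_edges (img @: T) = T.
Proof.
move/subsetP=> Ti; apply/setP => x; rewrite inE.
apply/andP/idP => [[xi /imsetP[y yT e]]|xT]; last by rewrite (Ti _ xT : incr x) imset_f.
by rewrite (img_inj xi (Ti _ yT) e).
Qed.

Lemma uniform_img T : T \subset incr -> uniform r (img @: T).
Proof.
move/subsetP=> Ti; apply/forall_inP => _ /imsetP[x xT ->].
by rewrite card_img //; apply: Ti.
Qed.

Lemma card_incr : #|[set x | incr x]| = 'C(n, r).
Proof.
rewrite -[n in RHS]card_ord -card_draws -card_sorted_edges; last first.
  by apply/forall_inP => A; rewrite inE.
by apply: eq_card => x; rewrite !inE; case xi: (incr x); rewrite // card_img ?eqxx.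
Qed.

(* w lists the vertices of the path; the a-th vertex is the (a mod r)-th
   smallest one in every edge containing it. *)
Definition has_crossing k T := exists w : nat -> nat,
  (forall a b, a < k + r - 1 -> b < k + r - 1 -> crossing_lt r a b -> w a < w b) /\
  (forall i, i < k -> exists2 x, x \in T &
     forall a, i <= a < i + r -> coord x (a %% r) = w a).

Lemma has_crossing_mono k k' T : k' <= k -> has_crossing k T -> has_crossing k' T.
Proof.
move=> kk [w [wm we]]; exists w; split; last by move=> i ik; apply: we; lia.
by move=> a b ak bk; apply: wm; lia.
Qed.

(** The one index in [[i, i + r)] congruent to [c] mod [r]: the factor [r.-1] stands for -1, so the
    offset is [c - i] mod [r]. *)
Definition window i c := i + (c + r.-1 * i) %% r.

Lemma window_bounds i c : 0 < r -> i <= window i c < i + r.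
Proof. by move=> r0; rewrite leq_addr ltn_add2l ltn_pmod. Qed.

Lemma window_mod i c : c < r -> window i c %% r = c.
Proof.
move=> cr; have r0 : 0 < r by lia.
by rewrite modnDmr addnCA -mulSn prednK // mulnC addnC modnMDl modn_small.
Qed.

Lemma window_uniq i a b : i <= a < i + r -> i <= b < i + r -> a = b %[mod r] -> a = b.
Proof.
wlog ab : a b / a <= b => [h|] ha hb e.
  by case: (leqP a b) => [ab|/ltnW ba]; [apply: h | apply/esym/h].
have /dvdnP[q eq] : r %| b - a by rewrite -eqn_mod_dvd // e.
by case: q eq => [|q]; nia.
Qed.

Lemma crossing_edgeP (w : nat -> nat) i x : 0 < r ->
  (forall a, i <= a < i + r -> coord x (a %% r) = w a) ->
  forall (j : 'I_r), val (x j) = w (window i j).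
Proof. by move=> r0 h j; rewrite -h ?window_bounds // window_mod // coordE. Qed.

(** Edge [i] of the path has one vertex in each residue class mod [r], and [crossing_lt] compares
    residues first. Listed increasingly, it therefore has vertex [window i c] at position [c]. *)
Lemma containsP k d (V : finOrderType d) (CP : {set {set V}}) (H : {set {set 'I_n}}) :
  0 < k -> 0 < r -> crossing_path r k CP ->
  contains H CP <-> has_crossing k (sorted_edges H).
Proof.
move=> k0 r0 [v [[vbij ->] cv]].
have {}cv : forall a b, (v a < v b)%O = crossing_lt r a b.
  by apply/crossing_orderP => //; lia.
have wlt i (c : 'I_r) : i < k -> window i c < k + r - 1.
  by move=> ik; have := window_bounds i c r0; lia.
split.
  move=> /existsP[f /andP[/forallP fm /forall_inP fe]].
  have {}fm (a b : 'I_(k + r - 1)) : crossing_lt r a b -> f (v a) < f (v b).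
    rewrite -cv => ab; move: (fm (v a)) => /forallP /(_ (v b)) /implyP /(_ ab).
    by [].
  pose w a := if insub a is Some o then val (f (v o)) else 0.
  have wE (o : 'I_(k + r - 1)) : w o = f (v o) by rewrite /w valK.
  exists w; split.
    move=> a b ak bk ab; rewrite (wE (Ordinal ak)) (wE (Ordinal bk)); exact: fm.
  move=> i ik.
  pose x := [ffun c : 'I_r => f (v (Ordinal (wlt i c ik)))].
  exists x.
    rewrite inE; apply/andP; split.
      apply/incrP => c c' cc; rewrite !ffunE; apply: fm.
      by rewrite /crossing_lt /= !window_mod // cc.
    suff -> : img x = f @: [set v j | j : 'I_(k + r - 1) & i <= j < i + r].
      by apply: fe; apply/imsetP; exists (Ordinal ik).
    apply/setP => p; apply/imsetP/imsetP => [[c _ ->]|[_ /imsetP[j + ->] ->]].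
      exists (v (Ordinal (wlt i c ik))); last by rewrite ffunE.
      by apply: imset_f; rewrite inE /= window_bounds.
    rewrite inE => ji; exists (Ordinal (ltn_pmod j r0)) => //.
    rewrite ffunE; congr (f (v _)); apply/val_inj => /=.
    by apply: (window_uniq ji); rewrite ?window_bounds // window_mod ?ltn_pmod.
  move=> a ai; have ak : a < k + r - 1 by lia.
  rewrite (coordE x (Ordinal (ltn_pmod a r0))) ffunE (wE (Ordinal ak)).
  congr (val (f (v _))); apply/val_inj => /=; apply/esym.
  by apply: (window_uniq ai); rewrite ?window_bounds // window_mod ?ltn_pmod.
case=> w [wm we].
have wn (o : 'I_(k + r - 1)) : w o < n.
  have oi : o - (r - 1) < k by have := ltn_ord o; lia.
  have [x _ <-] := we _ oi; last by have := ltn_ord o; lia.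
  exact/coord_lt/ltn_pmod.
have [v' vK v'K] := vbij.
apply/existsP; exists [ffun y => Ordinal (wn (v' y))].
apply/andP; split.
  apply/forallP => y; apply/forallP => z; apply/implyP.
  rewrite -{1}[y]v'K -{1}[z]v'K cv !ffunE => yz.
  exact: wm.
apply/forall_inP => _ /imsetP[i _ ->].
have [x + xe] := we i (ltn_ord i); rewrite inE => /andP[_ ].
suff <- : img x = [ffun y => Ordinal (wn (v' y))] @:
    [set v j | j : 'I_(k + r - 1) & i <= j < i + r] by [].
apply/setP => p.
apply/imsetP/imsetP => [[c _ ->]|[_ /imsetP[j + ->] ->]].
  exists (v (Ordinal (wlt i c (ltn_ord i)))).
    by apply: imset_f; rewrite inE /= window_bounds.
  by rewrite ffunE; apply/val_inj; rewrite /= vK /= (crossing_edgeP r0 xe).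
rewrite inE => ji; exists (Ordinal (ltn_pmod j r0)) => //.
by rewrite ffunE; apply/val_inj; rewrite /= vK -(xe j ji) -coordE.
Qed.

Lemma ex_ord_leq k d (V : finOrderType d) (CP : {set {set V}}) B :
  0 < k -> 0 < r -> crossing_path r k CP ->
  (forall T, T \subset incr -> ~ has_crossing k T -> #|T| <= B) ->
  ex_ord r n CP <= B.
Proof.
move=> k0 r0 hCP h; apply/bigmax_leqP => H /andP[uH nH].
rewrite -card_sorted_edges //; apply: h.
  by apply/subsetP => x; rewrite inE => /andP[].
by move/(containsP H k0 r0 hCP); apply/negP.
Qed.

Lemma leq_ex_ord k d (V : finOrderType d) (CP : {set {set V}}) T :
  0 < k -> 0 < r -> crossing_path r k CP ->
  T \subset incr -> ~ has_crossing k T -> #|T| <= ex_ord r n CP.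
Proof.
move=> k0 r0 hCP Ti nT.
rewrite -(sorted_edgesK Ti) card_sorted_edges ?uniform_img //.
apply: (leq_bigmax_cond (F := fun H : {set {set 'I_n}} => #|H|)).
rewrite uniform_img //=; apply/negP => /(containsP _ k0 r0 hCP).
by rewrite sorted_edgesK.
Qed.

(** Step [i] trades vertex [i] for vertex [i + r], both of which occupy coordinate [i %% r]. *)
Lemma walk_has_crossing k T (e : nat -> {ffun 'I_r -> 'I_n}) :
  0 < k -> 0 < r -> (forall i, i < k -> e i \in T) ->
  (forall i c, i.+1 < k -> c < r -> c != i %% r -> coord (e i.+1) c = coord (e i) c) ->
  (forall i, i.+1 < k -> coord (e i) (i %% r) < coord (e i.+1) (i %% r)) ->
  (forall i j c c', i < k -> j < k -> c < c' -> c' < r ->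
     coord (e i) c < coord (e j) c') ->
  has_crossing k T.
Proof.
move=> k0 r0 eT estay eup esep.
(* Vertex [a] first occurs in edge [a.+1 - r]; truncation sends the [r] initial vertices to edge
   0. *)
pose w a := coord (e (a.+1 - r)) (a %% r).
have mono c s t : c < r -> s <= t -> t < k -> coord (e s) c <= coord (e t) c.
  move=> cr; elim: t => [|t IH] st tk; first by have -> : s = 0 by lia.
  move: st; rewrite leq_eqVlt => /orP[/eqP-> //|st].
  apply: (leq_trans (IH _ _)); try lia.
  by case: (eqVneq c (t %% r)) => [->|h]; [apply/ltnW/eup | rewrite estay].
exists w; split.
  move=> a b ak bk; rewrite /crossing_lt /w => /orP[h|/andP[/eqP h ab]].
    by apply: esep; rewrite ?ltn_pmod //; lia.
  have /dvdnP[q eq] : r %| b - a by rewrite -eqn_mod_dvd 1?ltnW // h.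
  have rab : a + r <= b by case: q eq => [|q]; nia.
  have eb : b.+1 - r = (b - r).+1 by lia.
  have em : (b - r) %% r = b %% r by rewrite -[in RHS](subnK (leq_trans (leq_addl a r) rab)) modnDr.
  apply: (@leq_ltn_trans (coord (e (b - r)) (b %% r))).
    by rewrite h; apply: mono; rewrite ?ltn_pmod //; lia.
  by rewrite eb -em; apply: eup; lia.
move=> i ik; exists (e i); first exact: eT.
move=> a ai; rewrite /w.
have cst c s t : c < r -> s <= t -> t < k -> (forall l, s <= l < t -> c != l %% r) ->
    coord (e t) c = coord (e s) c.
  move=> cr; elim: t => [|t IH] st tk ne; first by have -> : s = 0 by lia.
  move: st; rewrite leq_eqVlt => /orP[/eqP-> //|st].
  rewrite estay //; last by apply: ne; lia.
  by apply: IH; try lia; move=> l lt; apply: ne; lia.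
apply: cst; rewrite ?ltn_pmod //; try lia.
(* Both [l] and [a] lie in [[l, l + r)], so equal residues would force [a = l], although
   [l < i <= a]. *)
move=> l /andP[l1 l2]; apply/eqP => e1.
have := window_uniq (i := l) (a := a) (b := l); lia.
Qed.

End IncreasingTuples.

Arguments incr {r n} x.

(** * Deletion and short paths *)

Section Deletion.
Variables (S : finType) (T : {set S}) (step : nat -> rel S) (K : nat).

(* Elements of T from which the last m of the K steps can be performed. *)
Fixpoint alive m : {set S} :=
  if m is m'.+1 then
    [set e in alive m' | [exists e' in alive m', step (K - m) e e']]
  else T.

Lemma alive_walk m e : m <= K -> e \in alive m ->
  exists w : nat -> S, [/\ w (K - m) = e, forall i, K - m <= i <= K -> w i \in T
    & forall i, K - m <= i < K -> step i (w i) (w i.+1)].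
Proof.
elim: m e => [|m IH] e mK.
  move=> eT; exists (fun=> e); split=> // i; lia.
rewrite inE => /andP[em /exists_inP[e' e'm st]].
have [w [w0 wT ws]] := IH _ (ltnW mK) e'm.
have eT : e \in T.
  elim: m em {IH mK e'm st w0 wT ws} => // m IH.
  by rewrite inE => /andP[/IH].
exists (fun i => if i == K - m.+1 then e else w i).
split=> [|i iK|i iK]; first by rewrite eqxx.
  by case: eqVneq => // ni; apply: wT; lia.
have -> : (i.+1 == K - m.+1) = false by lia.
case: eqVneq => [->|ni]; last by apply: ws; lia.
by have -> : (K - m.+1).+1 = K - m; [lia | rewrite w0].
Qed.

Lemma alive_sub m : alive m \subset T.
Proof.
elim: m => //= m; apply: subset_trans.
by apply/subsetP => e; rewrite inE => /andP[].
Qed.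

(** The alive sets decrease, so an element alive at stage [m] has passed the test for each of the
    last [m] steps. *)
Lemma alive_step m e i : m <= K -> e \in alive m -> K - m <= i < K ->
  exists2 e', e' \in T & step i e e'.
Proof.
elim: m => [|m IH] mK; first lia.
rewrite inE => /andP[em /exists_inP[e' e'm st]] iK.
case: (eqVneq i (K - m.+1)) => [->|ni]; last by apply: IH => //; lia.
by exists e'; rewrite ?(subsetP (alive_sub m)).
Qed.

(** Two distinct deleted elements in one fibre of [f] would be related by the step, and one of them
    would survive because the other was still alive. *)
Lemma removed_inj (S' : Type) (f : S -> S') m :
  {in T &, forall e e', f e = f e' -> e <> e' ->
     step (K - m.+1) e e' \/ step (K - m.+1) e' e} ->
  {in alive m :\: alive m.+1 &, injective f}.
Proof.
move=> tot e e'; rewrite !in_setD !inE.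
move=> /andP[+ em] /andP[+ e'm]; rewrite em e'm /= => ne ne' fe.
apply/eqP; apply/negPn/negP => /eqP ee'.
have [] := tot e e' _ _ fe ee'; try exact: (subsetP (alive_sub m)).
  by move=> st; case/exists_inP: ne; exists e'.
by move=> st; case/exists_inP: ne'; exists e.
Qed.

(** Without a walk nothing is alive after all [K] steps, so [T] is the union of the deleted layers;
    [b] bounds their accumulated size. *)
Lemma deletion (b : nat -> nat) :
  ~ (exists w : nat -> S, (forall i, i <= K -> w i \in T) /\
       (forall i, i < K -> step i (w i) (w i.+1))) ->
  (forall m, m < K -> #|alive m :\: alive m.+1| + b m <= b m.+1) ->
  #|T| + b 0 <= b K.
Proof.
move=> nw hb.
have cK m : m <= K -> #|T| + b 0 <= #|alive m| + b m.
  elim: m => // m IH mK; apply: (leq_trans (IH (ltnW mK))).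
  have := hb m mK; rewrite cardsD.
  have := subset_leq_card (subsetIl (alive m) (alive m.+1)).
  have := subset_leq_card (subsetIr (alive m) (alive m.+1)); lia.
suff : #|alive K| = 0 by have := cK K (leqnn K); lia.
apply/eqP; rewrite cards_eq0 -subset0; apply/subsetP => e /(alive_walk (leqnn K)).
rewrite subnn => -[w [_ wT ws]]; case: nw; exists w.
by split=> [i iK|i iK]; [apply: wT | apply: ws].
Qed.
End Deletion.

(** * Deleted edges and tight tuples *)

Section Exact.
Variables r n : nat.
Implicit Types (x y e : {ffun 'I_r -> 'I_n}) (T : {set {ffun 'I_r -> 'I_n}}).

Definition raises c : rel {ffun 'I_r -> 'I_n} := fun e e' =>
  [forall j : 'I_r, (val j != c) ==> (e j == e' j)] && (coord e c < coord e' c).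

Lemma raises_stay c c' e e' : raises c e e' -> c' != c -> coord e' c' = coord e c'.
Proof.
case/andP=> /forallP h _ cc'; case: (ltnP c' r) => c'r; last by rewrite !coord_oversize.
rewrite (coordE e (Ordinal c'r)) (coordE e' (Ordinal c'r)).
by have /implyP/(_ cc')/eqP-> := h (Ordinal c'r).
Qed.

Lemma raises_total c e e' : (forall j : 'I_r, val j != c -> e j = e' j) -> e <> e' ->
  raises c e e' \/ raises c e' e.
Proof.
move=> h ne.
case: (ltngtP (coord e c) (coord e' c)) => [lt|lt|eq].
- by left; rewrite /raises lt andbT; apply/forallP => j; apply/implyP => /h->.
- by right; rewrite /raises lt andbT; apply/forallP => j; apply/implyP => /h->.
case: ne; apply: coord_inj => c' c'r; case: (eqVneq c' c) => [->//|n'].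
by rewrite (coordE e (Ordinal c'r)) (coordE e' (Ordinal c'r)) h.
Qed.

Definition gap x c := (coord x c).+1 < coord x c.+1.

Definition tight K := [set x | incr x & [exists c : 'I_r, (c < K) && ~~ gap x c]].

(** Sends a deleted edge to a tight tuple. For increasing [x] and [c < r] the default of [insubd] is
    never taken. *)
Definition fill c x : {ffun 'I_r -> 'I_n} :=
  [ffun j => if val j == c then insubd (x j) (coord x c.+1).-1 else x j].

Lemma coord_le x c : incr x -> c <= r -> c <= coord x c.
Proof.
by move=> xi; elim: c => // c IH cr; have := coord_incr xi (ltnSn c) cr; lia.
Qed.

Lemma coord_fill c x c' : incr x -> c < r ->
  coord (fill c x) c' = if c' == c then (coord x c.+1).-1 else coord x c'.
Proof.
move=> xi cr; case: (ltnP c' r) => c'r; last first.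
  by rewrite !(coord_oversize _ c'r); case: eqVneq => // e; lia.
rewrite (coordE _ (Ordinal c'r)) ffunE /=; case: eqVneq => e; last first.
  by rewrite (coordE _ (Ordinal c'r)).
rewrite insubdK //; have := coord_incr xi (ltnSn c) cr.
rewrite unfold_in; move: cr; rewrite leq_eqVlt => /orP[/eqP cr|cr].
  by rewrite (@coord_oversize _ _ x c.+1) ?cr //; lia.
have := coord_lt x cr; lia.
Qed.

Lemma incr_coord x : (forall c, c.+1 < r -> coord x c < coord x c.+1) -> incr x.
Proof.
move=> h; apply/incrP => i j; rewrite -!coordE; have := ltn_ord j.
elim: (val j) => // l IH lr; rewrite ltnS leq_eqVlt => /orP[/eqP->|il]; first exact: h.
by apply: (ltn_trans (IH _ il)); [lia | exact: h].
Qed.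

Lemma fill_incr c x : incr x -> c < r -> incr (fill c x).
Proof.
move=> xi cr; apply: incr_coord => l lr; rewrite !coord_fill //.
have := coord_incr xi (ltnSn l) (ltnW lr).
have := coord_incr xi (ltnSn c) cr.
case: (eqVneq l c) => [->|lc]; last by case: (eqVneq l.+1 c) => [<-|]; lia.
by have -> : (c.+1 == c) = false; lia.
Qed.

Lemma path_free_leq K T : K <= r -> T \subset incr -> 0 < r ->
  ~ has_crossing K.+1 T -> #|T| <= #|tight K|.
Proof.
move=> Kr Ti r0 nT.
(* The layer deleted for position [K - m.+1] will be sent into [N m.+1] minus [N m]: that position
   becomes the last one below [K] without a gap. *)
pose N m := [set x in tight K | [exists c : 'I_r, (K - m <= c < K) && ~~ gap x c]].
have N0 : #|N 0| = 0.
  apply: eq_card0 => x; rewrite !inE; apply/negP => /andP[_ /existsP[c]].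
  by rewrite subn0; case/andP; lia.
have NK : N K = tight K.
  apply/setP => x; rewrite !inE subnn /=; case: (incr x) => //=.
  by rewrite andbb.
rewrite -NK -[#|T|]addn0 -N0.
apply: (@deletion _ T raises K (fun m => #|N m|)).
  move=> [e [eT es]]; apply: nT.
  have ei i : i <= K -> incr (e i) by move=> iK; apply: (subsetP Ti _ (eT i iK)).
  have cst c s t : s <= t <= K -> (forall l, s <= l < t -> c != l) ->
      coord (e t) c = coord (e s) c.
    elim: t => [|t IH] st ne; first by have -> : s = 0 by lia.
    case: (ltngtP s t.+1) => [st'| |->] //; last lia.
    rewrite (raises_stay (es t _)) ?ne //; try lia.
    by apply: IH; [lia | move=> l lt; apply: ne; lia].
  have rm i : i < K -> i %% r = i by move=> iK; rewrite modn_small //; lia.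
  apply: (@walk_has_crossing _ _ _ _ e) => // [i c iK cr ci|i iK|i j c c' iK jK cc c'r].
  - by rewrite (raises_stay (es i _)) //; rewrite rm in ci.
  - by rewrite rm //; case/andP: (es i iK).
  (* Coordinate [c] is raised only by step [c], while coordinate [c.+1] still has its initial value.
     So it stays below [coord (e 0) c.+1], and later coordinates never drop below their initial
     values. *)
  have mono t : t <= K -> coord (e 0) c' <= coord (e t) c'.
    move=> tK; case: (leqP t c') => h.
      by rewrite (cst c' 0 t) //; lia.
    rewrite (cst c' c'.+1 t); try lia.
    rewrite -(cst c' 0 c'); try lia.
    by apply: ltnW; case/andP: (es c' (leq_trans h tK)).
  apply: leq_trans (mono j jK).
  apply: (@leq_trans (coord (e 0) c.+1)); last first.
    case: (ltngtP c.+1 c') => [h| |->] //; last lia.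
    by apply/ltnW/coord_incr => //; [apply: ei | lia].
  case: (leqP i c) => ic.
    rewrite (cst c 0 i); try lia.
    by apply: coord_incr => //; [apply: ei | lia].
  rewrite (cst c c.+1 i); try lia.
  rewrite -(cst c.+1 0 c.+1); try lia.
  by apply: coord_incr => //; [apply: ei; lia | lia].
move=> m mK; set c := K - m.+1; have cE : c = K - m.+1 by [].
have cr : c < r by lia.
have /card_in_imset <- : {in alive T raises K m :\: alive T raises K m.+1 &, injective (fill c)}.
  apply: removed_inj => e e' eT e'T fe; apply: raises_total => j jc.
  by move/ffunP: fe => /(_ j); rewrite !ffunE (negPf jc).
set D := fill c @: _.
have sub : D \subset N m.+1 :\: N m.
  apply/subsetP => _ /imsetP[e /setDP[em _] ->].
  have eT := subsetP (alive_sub _ _ _ m) _ em.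
  have xi : incr e := subsetP Ti _ eT.
  have ng : ~~ gap (fill c e) c.
    rewrite /gap !coord_fill // eqxx; have -> : (c.+1 == c) = false by lia.
    have := coord_incr xi (ltnSn c) cr; lia.
  rewrite !inE fill_incr //=; apply/and3P; split.
  - rewrite negb_and; apply/orP; right; apply/existsPn => j.
    rewrite negb_and negbK -implybE; apply/implyP => jK.
    rewrite /gap !coord_fill //.
    have -> : (j == c :> nat) = false by lia.
    have -> : (j.+1 == c) = false by lia.
    (* Having passed the test for step [j], [e] can raise entry [j] and still stay below entry
       [j.+1], so it has a gap at [j]; [fill c] with [c < j] leaves both entries alone. *)
    have [e' e'T st] := alive_step (ltnW mK) em jK.
    case/andP: (st) => _ lt.
    rewrite -(raises_stay (c' := j.+1) st); last by lia.
    apply: leq_ltn_trans lt _; apply: coord_incr => //; exact: (subsetP Ti _ e'T).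
  - by apply/existsP; exists (Ordinal cr); rewrite ng andbT /=; lia.
  - by apply/existsP; exists (Ordinal cr); rewrite ng andbT /=; lia.
have NN : N m \subset N m.+1.
  apply/subsetP => x; rewrite !inE => /andP[-> /existsP[j /andP[jK g]]].
  by apply/existsP; exists j; rewrite g andbT; lia.
have := subset_leq_card sub; rewrite cardsD (setIidPr NN).
have := subset_leq_card NN; lia.
Qed.

(** Vertex [c + r] lies strictly between entries [c] and [c.+1] of the first edge, which forces a
    gap at each [c < K]. For [c.+1 = r] the upper entry is the sentinel [n]. *)
Lemma tight_path_free K : K <= r -> 0 < r -> ~ has_crossing K.+1 (tight K).
Proof.
move=> Kr r0 [w [wm we]].
have [x] := we 0 isT; rewrite inE => /andP[xi /existsP[c /andP[cK ng]]] xw.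
have cr := ltn_ord c.
have xc : coord x c = w c by rewrite -xw ?modn_small.
have l1 : w c < w (c + r).
  by apply: wm; try lia; rewrite /crossing_lt modnDr eqxx /=; lia.
case/negP: ng; rewrite /gap xc.
case: (ltnP c.+1 r) => cr'.
  rewrite -(modn_small cr') xw; last by lia.
  apply: leq_ltn_trans l1 _; apply: wm; try lia.
  rewrite /crossing_lt modnDr !modn_small //; lia.
rewrite coord_oversize //; apply: leq_ltn_trans l1 _.
have [y _ yw] := we c.+1 (cK : c.+1 < K.+1).
by rewrite -yw; [apply/coord_lt/ltn_pmod | lia].
Qed.

End Exact.

(** * Counting tight tuples *)

Section CountTight.
Variables r n K : nat.
Hypothesis Kn : K <= n.

Lemma shift_subproof (c : 'I_r) (p : 'I_(n - K)) : p + minn c K < n.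
Proof. by have := ltn_ord p; have := geq_minr c K; lia. Qed.

(** The inverse of closing up the gaps: the offset grows by one at each position below [K], so the
    images are exactly the increasing tuples that are not tight. *)
Definition shift (y : {ffun 'I_r -> 'I_(n - K)}) : {ffun 'I_r -> 'I_n} :=
  [ffun c => Ordinal (shift_subproof c (y c))].

Lemma coord_shift y c : c < r -> coord (shift y) c = coord y c + minn c K.
Proof.
by move=> cr; rewrite (coordE _ (Ordinal cr)) (coordE _ (Ordinal cr)) ffunE.
Qed.

Lemma card_tight : K <= r -> 0 < r -> #|@tight r n K| = 'C(n, r) - 'C(n - K, r).
Proof.
move=> Kr r0; rewrite -(card_incr r n) -(card_incr r (n - K)).
have shift_inj : injective shift.
  move=> y y' e; apply: coord_inj => c cr; have := coord_shift y cr.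
  by rewrite e coord_shift //; lia.
rewrite -(card_imset _ shift_inj).
set G := shift @: _.
suff -> : G = [set x | incr x] :\: @tight r n K.
  rewrite cardsD.
  have /setIidPr -> : @tight r n K \subset [set x | incr x].
    by apply/subsetP => x; rewrite !inE => /andP[].
  have : @tight r n K \subset [set x | incr x].
    by apply/subsetP => x; rewrite !inE => /andP[].
  by move/subset_leq_card; lia.
apply/setP => x; rewrite !inE; apply/imsetP/andP.
  case=> y; rewrite inE => yi ->.
  have si : incr (shift y).
    apply: incr_coord => c cr; rewrite !coord_shift //; last lia.
    have := coord_incr yi (ltnSn c) (ltnW cr); lia.
  split=> //; rewrite si /=; apply/existsPn => c.
  rewrite negb_and negbK -implybE; apply/implyP => cK.
  have cr := ltn_ord c; rewrite /gap coord_shift //.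
  have := coord_incr yi (ltnSn c) cr.
  case: (ltnP c.+1 r) => cr'; first by rewrite coord_shift //; lia.
  by rewrite !(coord_oversize _ cr'); lia.
case=> + xi; rewrite xi /= => /existsPn ng.
have step c : c < r -> coord x c - minn c K < coord x c.+1 - minn c.+1 K.
  move=> cr; have := coord_incr xi (ltnSn c) cr.
  have := coord_le xi (ltnW cr); have := coord_le xi cr.
  case: (ltnP c K) => cK; last by lia.
  by have := ng (Ordinal cr); rewrite cK negbK /gap /=; lia.
have bnd c : c < r -> coord x c - minn c K < n - K.
  (* The induction descends from the sentinel, where [n - minn r K] is [n - K] because [K <= r]. *)
  move=> cr; have [l e] : exists l, c + l.+1 = r by exists (r - c.+1); lia.
  elim: l c cr e => [|l IH] c cr e.
    have := step c cr; rewrite (@coord_oversize _ _ x c.+1); lia.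
  by apply: (ltn_trans (step c cr)); apply: IH; lia.
pose y := [ffun c : 'I_r => Ordinal (bnd c (ltn_ord c))].
have cy c : c < r -> coord y c = coord x c - minn c K.
  by move=> cr; rewrite (coordE _ (Ordinal cr)) ffunE.
exists y.
  rewrite inE; apply: incr_coord => c cr; rewrite !cy //; last lia.
  by apply: step; lia.
apply: coord_inj => c cr; rewrite coord_shift // cy //.
by have := coord_le xi (ltnW cr); lia.
Qed.
End CountTight.

Theorem ex_ord_short k r n d (V : finOrderType d) (CP : {set {set V}}) :
  0 < k -> 0 < r -> crossing_path r k CP -> k <= r + 1 -> r + k <= n ->
  ex_ord r n CP = 'C(n, r) - 'C(n - k + 1, r).
Proof.
move=> k0 r0 hCP kr kn.
have ek : k = k.-1.+1 by lia.
have -> : n - k + 1 = n - k.-1 by lia.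
rewrite -card_tight //; try lia.
apply/eqP; rewrite eqn_leq; apply/andP; split.
  by apply: (ex_ord_leq k0 r0 hCP) => T Ti; rewrite ek; apply: path_free_leq; lia.
apply: (leq_ex_ord k0 r0 hCP); last by rewrite {1}ek; apply: tight_path_free; lia.
by apply/subsetP => x; rewrite inE => /andP[].
Qed.

(** * Long paths *)

Section Level.

Lemma level_exists x y : exists a, x %/ 2 ^ a == y %/ 2 ^ a.
Proof.
exists (x + y); rewrite !divn_small //.
  exact: leq_ltn_trans (leq_addl x y) (ltn_expl _ _).
exact: leq_ltn_trans (leq_addr y x) (ltn_expl _ _).
Qed.

(* The dyadic blocks of length 2 ^ level x y are the smallest ones that do not
   separate x from y. *)
Definition level x y := ex_minn (level_exists x y).

Lemma level_leP x y a : (level x y <= a) = (x %/ 2 ^ a == y %/ 2 ^ a).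
Proof.
rewrite /level; case: ex_minnP => l /eqP xl lmin; apply/idP/idP => [la|/lmin//].
by rewrite -(subnKC la) expnD !divnMA xl.
Qed.

Lemma level_le_bound x y L : x < 2 ^ L -> y < 2 ^ L -> level x y <= L.
Proof. by move=> xL yL; rewrite level_leP !divn_small. Qed.

(** Dyadic blocks are intervals, so one that holds [p] and [s] also holds [q]. *)
Lemma level_max p q s : p <= q -> q <= s ->
  level p s = maxn (level p q) (level q s).
Proof.
move=> pq qs; apply/eqP; rewrite eqn_leq geq_max; apply/and3P; split.
- rewrite level_leP.
  have /eqP-> : p %/ 2 ^ maxn (level p q) (level q s)
      == q %/ 2 ^ maxn (level p q) (level q s) by rewrite -level_leP leq_maxl.
  by rewrite -level_leP leq_maxr.
- have := leqnn (level p s); rewrite !level_leP => /eqP e.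
  by rewrite eqn_leq leq_div2r //= e leq_div2r.
have := leqnn (level p s); rewrite !level_leP => /eqP e.
by rewrite eqn_leq leq_div2r //= -e leq_div2r.
Qed.

(** The two halves of the smallest common block separate [p] from [q]. *)
Lemma level_split p q : p < q ->
  q %/ 2 ^ (level p q).-1 = (p %/ 2 ^ (level p q).-1).+1.
Proof.
move=> pq; have l0 : 0 < level p q by rewrite ltnNge level_leP !divn1; lia.
have : (level p q).-1 < level p q by lia.
rewrite ltnNge level_leP.
have := leqnn (level p q); rewrite level_leP -{1 2}(prednK l0) expnSr !divnMA.
have := leq_div2r (2 ^ (level p q).-1) (ltnW pq).
by move: (_ %/ _) (q %/ _) => u v; lia.
Qed.

(** By [level_max] the larger of the two levels is [level p s], which does not depend on [q]. The
    smaller level and a bit telling which one it is thus determine both. *)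
Definition level_code p q s :=
  (level p q < level q s, minn (level p q) (level q s)).

Lemma level_codeP p q q' s : p <= q <= s -> p <= q' <= s ->
  level_code p q s = level_code p q' s ->
  level p q = level p q' /\ level q s = level q' s.
Proof.
move=> /andP[pq qs] /andP[pq' qs'] [].
have := level_max pq qs; rewrite (level_max pq' qs'); lia.
Qed.
End Level.

(** * Upper bound for long paths *)

Section UpperBound.
Variables r n : nat.
Implicit Types (x y e : {ffun 'I_r -> 'I_n}) (T : {set {ffun 'I_r -> 'I_n}}).

(* Shifted by one so that every coordinate has a neighbour on both sides. *)
Definition place e c := if c is c'.+1 then (coord e c').+1 else 0.

(** Coordinate [c] sits at place [c.+1], so this encodes the two levels next to it. *)
Definition code e c := level_code (place e c) (place e c.+1) (place e c.+2).

Lemma place_lt e c : incr e -> c <= r -> place e c < place e c.+1.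
Proof. by move=> ei; case: c => // c cr; have := coord_incr ei (ltnSn c) cr. Qed.

Lemma place_stay c c' e e' : raises c e e' -> c' != c.+1 -> place e' c' = place e c'.
Proof.
case: c' => // c' st ne /=; rewrite (raises_stay st) //.
Qed.

Definition code_step i : rel {ffun 'I_r -> 'I_n} := fun e e' =>
  raises (i %% r) e e' && (code e (i %% r) == code e' (i %% r)).

Lemma code_step_levels i e e' c : incr e -> incr e' -> 0 < r -> c <= r ->
  code_step i e e' -> level (place e c) (place e c.+1) = level (place e' c) (place e' c.+1).
Proof.
move=> ei e'i r0 cr /andP[st /eqP]; have dr : i %% r < r by rewrite ltn_pmod.
set d := i %% r in st dr *.
rewrite /code (place_stay (c' := d) st); last lia.
rewrite (place_stay (c' := d.+2) st); last lia.
have := place_lt ei (ltnW dr); have := place_lt e'i (ltnW dr).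
have := place_lt ei dr; have := place_lt e'i dr.
rewrite (place_stay (c' := d) st); last lia.
rewrite (place_stay (c' := d.+2) st); last lia.
move=> h1 h2 h3 h4 /level_codeP[]; try lia.
case: (eqVneq c d) => [->|cd]; first by rewrite (place_stay (c' := d) st) //; lia.
case: (eqVneq c d.+1) => [->|cd1] //; first by rewrite (place_stay (c' := d.+2) st) //; lia.
by move=> _ _; rewrite !(place_stay st) //; lia.
Qed.

Lemma code_walk_separated K (e : nat -> {ffun 'I_r -> 'I_n}) i j c c' :
  (forall t, t <= K -> incr (e t)) ->
  (forall t, t < K -> code_step t (e t) (e t.+1)) ->
  i <= K -> j <= K -> c < c' -> c' < r -> coord (e i) c < coord (e j) c'.
Proof.
move=> ei es iK jK cc c'r; have r0 : 0 < r by lia.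
apply: (@leq_trans (coord (e j) c.+1)); last first.
  case: (ltngtP c.+1 c') => [h| |->] //; last lia.
  by apply/ltnW/coord_incr => //; [apply: ei | lia].
have cr : c.+1 < r by lia.
pose l := level (place (e 0) c.+1) (place (e 0) c.+2).
(* The upper entry keeps its half block: when it is raised, [level_split] ties it to the unmoved
   lower entry. So one midpoint separates the two coordinates at all times. *)
have inv t : t <= K -> level (place (e t) c.+1) (place (e t) c.+2) = l /\
    place (e t) c.+2 %/ 2 ^ l.-1 = place (e 0) c.+2 %/ 2 ^ l.-1.
  elim: t => // t IH tK; have [IHl IHs] := IH (ltnW tK).
  have L := code_step_levels (ei t (ltnW tK)) (ei _ tK) r0 (ltnW cr) (es t tK).
  split; first by rewrite -L.
  rewrite -IHs; have /andP[st _] := es t tK.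
  case: (eqVneq c.+2 (t %% r).+1) => [ec|nc]; last by rewrite (place_stay st).
  have := level_split (place_lt (ei _ tK) (ltnW cr)).
  have := level_split (place_lt (ei t (ltnW tK)) (ltnW cr)).
  rewrite -L IHl => -> ->; rewrite (place_stay st) //; lia.
have [li si] := inv i iK; have [lj sj] := inv j jK.
have := level_split (place_lt (ei i iK) (ltnW cr)); rewrite li si -sj.
case: (ltnP (coord (e i) c) (coord (e j) c.+1)) => // h.
have := leq_div2r (2 ^ l.-1) (h : place (e j) c.+2 <= place (e i) c.+1); lia.
Qed.

Lemma crossing_free_leq k L T : 0 < k -> 0 < r -> n.+1 < 2 ^ L -> T \subset incr ->
  ~ has_crossing k T -> #|T| <= k.-1 * (n ^ r.-1 * (2 * L.+1)).
Proof.
move=> k0 r0 nL Ti nT; set B := n ^ _ * _.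
rewrite -[#|T|]addn0 -[X in _ + X <= _](mul0n B).
apply: (@deletion _ T code_step k.-1 (fun m => m * B)).
  move=> [e [eT es]]; apply: nT.
  have ei t : t <= k.-1 -> incr (e t) by move=> tK; apply: (subsetP Ti _ (eT t tK)).
  apply: (@walk_has_crossing _ _ _ _ e) => // [i ik|i c iK cr ci|i iK|i j c c' iK jK cc c'r].
  - by apply: eT; lia.
  - by rewrite (@raises_stay _ _ (i %% r) c (e i)) //; case/andP: (es i ltac:(lia)).
  - by case/andP: (es i ltac:(lia)) => /andP[].
  - by apply: (@code_walk_separated k.-1) => //; lia.
move=> m mK; rewrite mulSn leq_add2r.
set i := k.-1 - m.+1; have cr : i %% r < r by rewrite ltn_pmod.
pose c := Ordinal cr.
have codeL e : incr e -> (code e c).2 < L.+1.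
  move=> ei; rewrite ltnS geq_min; apply/orP; left.
  (* The sentinel is shifted too, so places reach [n.+1]. *)
  have pL d : d <= r -> place e d.+1 < 2 ^ L.
    move=> dr; case: (ltnP d r) => h; first by have := coord_lt e h; rewrite /=; lia.
    by rewrite /= coord_oversize.
  apply: level_le_bound; last exact/pL/ltnW.
  by apply: leq_ltn_trans (ltnW (place_lt ei _)) (pL c _); rewrite ltnW.
(* The other [r.-1] entries, the bit and a level of at most [L] account for the factors of [B]. *)
pose phi e := ([ffun j : 'I_r.-1 => e (lift c j)],
               ((code e c).1, inord (code e c).2 : 'I_L.+1)).
have phi_inj : {in alive T code_step k.-1 m :\: alive T code_step k.-1 m.+1 &, injective phi}.
  apply: removed_inj => e e' eT e'T [fe c1 c2] ne.
  have ce : code e c = code e' c.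
    apply/eqP; rewrite -pair_eqE /= /pair_eq c1 eqxx /=.
    have := congr1 val c2; rewrite /= !inordK ?codeL //; try exact: (subsetP Ti).
    by move->.
  rewrite /code_step -/i ce eqxx !andbT; apply: raises_total => // j jc.
  case: (unliftP c j) => [j' ->|jE]; last by rewrite jE eqxx in jc.
  by move/ffunP: fe => /(_ j'); rewrite !ffunE.
rewrite -(card_in_imset phi_inj); apply: leq_trans (max_card _) _.
by rewrite !card_prod card_ffun !card_ord card_bool.
Qed.

End UpperBound.

(** * Lower bound for long paths *)

Section LowerBound.
Variables r n : nat.
Hypothesis r_gt1 : 1 < r.

(** Bounding the exponent by [n] loses nothing, since [a < 2 ^ a <= coord x 1 < n]. *)
Definition pow2_edges :=
  [set x : {ffun 'I_r -> 'I_n} | incr x & [exists a : 'I_n, coord x 1 == coord x 0 + 2 ^ a]].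

(* In a path with r + 2 edges, the vertices v_r < v_2r < v_1 < v_(r+1) satisfy
   v_1 - v_r = 2^b, v_(r+1) - v_r = 2^c and v_(r+1) - v_2r = 2^d; hence b, d < c
   and 2^c < 2^b + 2^d, which is absurd. *)
Lemma pow2_edges_free k : r + 2 <= k -> ~ has_crossing k pow2_edges.
Proof.
move=> rk /(has_crossing_mono rk)[w [wm we]].
have gap i u v : i < r + 2 -> i <= u < i + r -> i <= v < i + r ->
    u %% r = 0 -> v %% r = 1 -> exists b, w v = w u + 2 ^ b.
  move=> ik ui vi u0 v1; have [x] := we i ik.
  rewrite inE => /andP[_ /existsP[b /eqP xb]] xw.
  by exists b; rewrite -(xw v vi) -(xw u ui) u0 v1.
have r0 : r %% r = 0 by rewrite modnn.
have r1 : r.+1 %% r = 1 by rewrite -addn1 modnDl modn_small.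
have o1 : 1 %% r = 1 by rewrite modn_small.
have rr0 : (r + r) %% r = 0 by rewrite modnDr modnn.
have [b wb] := gap 1 r 1 ltac:(lia) ltac:(lia) ltac:(lia) r0 o1.
have [c wc] := gap 2 r r.+1 ltac:(lia) ltac:(lia) ltac:(lia) r0 r1.
have [d wd] := gap r.+1 (r + r) r.+1 ltac:(lia) ltac:(lia) ltac:(lia) rr0 r1.
have h1 : w (r + r) < w 1 by apply: wm; rewrite /crossing_lt ?rr0 ?o1 //; lia.
have h2 : w 1 < w r.+1 by apply: wm; rewrite /crossing_lt ?r1 ?o1 //; lia.
have h3 : w r < w (r + r) by apply: wm; rewrite /crossing_lt ?r0 ?rr0 //=; lia.
have bc : b < c by rewrite -(ltn_exp2l b c (ltnSn 1)); lia.
have dc : d < c by rewrite -(ltn_exp2l d c (ltnSn 1)); lia.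
case: c wc bc dc => // c wc bc dc.
have := leq_pexp2l (isT : 0 < 2) (bc : b <= c).
have := leq_pexp2l (isT : 0 < 2) (dc : d <= c).
move: wc; rewrite expnS; lia.
Qed.

Lemma card_pow2_edges m A : m * r <= n -> (forall a, a < A -> 2 ^ a <= m) ->
  m ^ r.-1 * A <= #|pow2_edges|.
Proof.
move=> mn hA.
(* Entry 0 is free below [m], entry 1 stays below [2 * m], and each later entry [c] is free in its
   own block starting at [c * m]: [r.-1] free entries and one exponent. *)
pose f (y : {ffun 'I_r.-1 -> 'I_m}) a c :=
  match c with 0 => coord y 0 | 1 => coord y 0 + 2 ^ a | c'.+1 => c * m + coord y c' end.
have y0 (y : {ffun 'I_r.-1 -> 'I_m}) : coord y 0 < m by apply: coord_lt; lia.
have f_lt y a c : a < A -> c < r -> f y a c < c.+1 * m.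
  move=> /hA am cr; have := y0 y; case: c cr => [|[|c]] cr /=; try lia.
  have : coord y c.+1 < m by apply: coord_lt; lia.
  by rewrite !mulSn; lia.
have f_ltn y (a : 'I_A) (c : 'I_r) : f y a c < n.
  apply: leq_trans (f_lt _ _ _ (ltn_ord a) (ltn_ord c)) _.
  by apply: leq_trans mn; rewrite mulnC leq_mul.
pose g (p : {ffun 'I_r.-1 -> 'I_m} * 'I_A) := [ffun c : 'I_r => Ordinal (f_ltn p.1 p.2 c)].
have gE p c : c < r -> coord (g p) c = f p.1 p.2 c.
  by move=> cr; rewrite (coordE _ (Ordinal cr)) ffunE.
have g_inj : injective g.
  move=> [y a] [y' a'] e.
  have ef c : c < r -> f y a c = f y' a' c.
    by move=> cr; have := gE (y, a) c cr; rewrite e gE.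
  have e0 : coord y 0 = coord y' 0 by apply: (ef 0); lia.
  have := ef 1 r_gt1; rewrite /= e0 => /eqP.
  rewrite eqn_add2l eqn_exp2l // => /eqP/val_inj->.
  congr (_, _); apply: coord_inj => -[//|c] cr.
  have := ef c.+2 ltac:(lia); rewrite /=; lia.
have -> : m ^ r.-1 * A = #|[set: {ffun 'I_r.-1 -> 'I_m} * 'I_A]|.
  by rewrite cardsT card_prod card_ffun !card_ord.
rewrite -(card_imset _ g_inj); apply/subset_leq_card/subsetP => _ /imsetP[[y a] _ ->].
rewrite inE; apply/andP; split.
  apply: incr_coord => c cr; rewrite !gE //; last lia.
  case: c cr => [|c] cr; first by rewrite /= -addn1 leq_add2l expn_gt0.
  by apply: leq_trans (f_lt _ _ _ (ltn_ord a) _) _; [lia | rewrite /= leq_addr].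
have an : a < n.
  have := hA _ (ltn_ord a); have := ltn_expl a (isT : 1 < 2); nia.
by apply/existsP; exists (Ordinal an); rewrite !gE //; lia.
Qed.

End LowerBound.

Lemma ex_ord_upper k r n L d (V : finOrderType d) (CP : {set {set V}}) :
  0 < k -> 0 < r -> crossing_path r k CP -> n.+1 < 2 ^ L ->
  ex_ord r n CP <= k.-1 * (n ^ r.-1 * (2 * L.+1)).
Proof.
by move=> k0 r0 hCP nL; apply: (ex_ord_leq k0 r0 hCP) => T; apply: crossing_free_leq.
Qed.

Lemma ex_ord_lower k r n m A d (V : finOrderType d) (CP : {set {set V}}) :
  1 < r -> r + 2 <= k -> crossing_path r k CP ->
  m * r <= n -> (forall a, a < A -> 2 ^ a <= m) ->
  m ^ r.-1 * A <= ex_ord r n CP.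
Proof.
move=> r1 rk hCP mn hA.
apply: leq_trans (card_pow2_edges r1 mn hA) _.
apply: (leq_ex_ord (k := k)) hCP _ _; try lia; last exact: pow2_edges_free.
by apply/subsetP => x; rewrite inE => /andP[].
Qed.

From mathcomp Require Import all_algebra lra.
From mathcomp Require Import all_classical all_reals all_analysis.
Import numFieldNormedType.Exports.
Import Order.TTheory GRing.Theory Num.Theory.

(** * From binary to natural logarithms *)

Section Asymptotics.
Variable R : realType.
Local Open Scope ring_scope.

Lemma ln_nat_le (a b c : nat) : (0 < a)%N -> (a <= b ^ c)%N ->
  ln a%:R <= c%:R * ln b%:R :> R.
Proof.
move=> a0 abc; case: (posnP c) abc => [->|c0] abc.
  have -> : a = 1%N by move: abc; rewrite expn0; lia.
  by rewrite ln1 mul0r.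
have b0 : (0 < b)%N.
  by rewrite lt0n; apply: contraTN abc => /eqP->; rewrite exp0n // -ltnNge.
rewrite mulr_natl -lnXn ?ltr0n // -natrX ler_ln ?posrE ?ltr0n ?expn_gt0 ?b0 //.
by rewrite ler_nat.
Qed.

Lemma ln2_gt0 : 0 < ln 2%:R :> R.
Proof. by rewrite ln_gt0 // ltr1n. Qed.

(** From [2 ^ t <= n.+2 <= n ^ 2] follows [t * ln 2 <= 2 * ln n]; with [ln 2 <= ln n], the product
    [2 * (t + 2) * ln 2] is at most [8 * ln n]. *)
Lemma trunc_log_upper (n : nat) : (2 <= n)%N ->
  (2 * (trunc_log 2 n.+2).+2)%:R <= 8 / ln 2%:R * ln n%:R :> R.
Proof.
move=> n2; set t := trunc_log _ _.
have h1 : t%:R * ln 2%:R <= 2%:R * ln n%:R :> R.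
  apply: (@le_trans _ _ (ln n.+2%:R)).
    rewrite mulr_natl -lnXn ?ltr0n // -natrX.
    by rewrite ler_ln ?posrE ?ltr0n ?expn_gt0 // ler_nat trunc_logP.
  by apply: ln_nat_le => //; nia.
have h2 : ln 2%:R <= ln n%:R :> R by rewrite ler_ln ?posrE ?ltr0n ?ler_nat //; lia.
rewrite mulrAC ler_pdivlMr ?ln2_gt0 // natrM -[t.+2]addn2 natrD.
move: h1 h2; set a := ln _; set b := ln _.
by move=> h1 h2; lra.
Qed.

Lemma trunc_log_lower (n m : nat) : (0 < n)%N -> (n <= m ^ 2)%N ->
  ln n%:R <= (2 * ln 2%:R) * (trunc_log 2 m).+1%:R :> R.
Proof.
move=> n0 nm; apply: (le_trans (ln_nat_le n0 nm)).
rewrite -mulrA ler_wpM2l // mulrC.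
apply: ln_nat_le; first by lia.
exact/ltnW/trunc_log_ltn.
Qed.

End Asymptotics.

Local Open Scope classical_set_scope.

Theorem theorem2p3 (R : realType) (k r : nat) (hk : 1 <= k) (hr : 2 <= r)
    (d : Order.disp_t) (V : finOrderType d) (CP : {set {set V}})
    (hCP : crossing_path r k CP) :
  (k <= r + 1 -> forall n : nat, r + k <= n ->
     ex_ord r n CP = 'C(n, r) - 'C(n - k + 1, r)) /\
  (r + 2 <= k ->
     (fun n : nat => (ex_ord r n CP)%:R : R^o)%R
       =Theta_\oo (fun n : nat => n%:R ^+ (r - 1) * ln n%:R : R^o)%R).
Proof.
have r0 : 0 < r by lia.
split=> [kr n kn|rk]; first exact: (ex_ord_short (k := k)).
have L0 := ln2_gt0 R.
rewrite eqThetaE qualifE; apply/asboolP.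
(* Below, [n <= 2 * r * m] costs the power of [2 * r] and [n <= m ^ 2] costs [2 * ln 2]; above,
   there are [k.-1] deletion steps. *)
exists (((2 * r)%:R ^+ (r - 1) * (2 * ln 2%:R))^-1, (k.-1%:R * (8 / ln 2%:R)))%R => /=.
  apply/andP; split.
    by rewrite invr_gt0 !mulr_gt0 ?exprn_gt0 ?ltr0n //; lia.
  by rewrite !mulr_gt0 ?invr_gt0 ?ltr0n //; lia.
(* From here on [m = n %/ r] satisfies [n <= 2 * r * m], hence [(2 * r) ^ 2 * n <= n ^ 2 <= (2 * r)
   ^ 2 * m ^ 2]. *)
exists ((2 * r) ^ 2) => // n /= nr.
have n1 : 1 < n by nia.
have n0 : 0 < n by lia.
have lnn0 : (0 <= ln n%:R :> R)%R by rewrite ln_ge0 // ler1n.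
rewrite !ger0_norm ?mulr_ge0 ?exprn_ge0 //; split.
  pose m := n %/ r.
  have mn : m * r <= n by apply: leq_trunc_div.
  have nm : n < m.+1 * r by apply: ltn_ceil.
  have m0 : 0 < m by rewrite divn_gt0 //; nia.
  have nm2 : n <= (2 * r) * m by nia.
  have nmm : n <= m ^ 2.
    rewrite -(leq_pmul2r (_ : 0 < (2 * r) ^ 2)) ?expn_gt0 ?muln_gt0 ?r0 //.
    by rewrite -expnMn mulnC [m * _]mulnC; apply: (@leq_trans (n * n)); nia.
  have low : m ^ r.-1 * (trunc_log 2 m).+1 <= ex_ord r n CP.
    apply: (ex_ord_lower (k := k)) => // a at0.
    by apply: leq_trans (@trunc_logP 2 m isT m0); rewrite leq_exp2l.
  apply: (@le_trans _ _ ((m ^ r.-1 * (trunc_log 2 m).+1)%:R)%R); last by rewrite ler_nat.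
  rewrite mulrC ler_pdivrMr; last by rewrite !mulr_gt0 ?exprn_gt0 ?ltr0n //; lia.
  rewrite natrM natrX subn1 mulrACA [X in (_ <= X * _)%R]mulrC -exprMn -natrM.
  rewrite [X in (_ <= _ * X)%R]mulrC; apply: ler_pM => //.
    by apply: lerXn2r; rewrite ?nnegrE ?ler_nat.
  exact: trunc_log_lower.
have nL : n.+1 < 2 ^ (trunc_log 2 n.+2).+1 by apply: leq_trans (trunc_log_ltn _ _); lia.
apply: (@le_trans _ _ ((k.-1 * (n ^ r.-1 * (2 * (trunc_log 2 n.+2).+2)))%:R)%R).
  by rewrite ler_nat; apply: ex_ord_upper.
rewrite natrM -mulrA ler_wpM2l // natrM natrX subn1 mulrCA ler_wpM2l ?exprn_ge0 //.
exact: trunc_log_upper.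
Qed.
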